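(* Let $G$ be a finite group with $n=\operatorname{card}(G)\ge 2$ and let $p\in[1,\infty)$. Then: (1) as vector spaces, $F_0^p(G)=\ell_0^1(G)=\operatorname{span}\{\Delta_g : g\in G\}=\mathbb{C}_0[G]\cong\mathbb{C}^{n-1}$; (2) for any $a\in\ell_0^1(G)$, $a\left(\sum_{g\in G}\delta_g\right)=\left(\sum_{g\in G}\delta_g\right)a=0$; (3) $F_0^p(G)$ has an identity element given by $\mathbf{1}_0=-\frac1n\sum_{g\in G}\Delta_g$; (4) $\dfrac{((n-1)^p+n-1)^{1/p}}{n}\le\|\mathbf{1}_0\|_{F^p(G)}\le 2-\dfrac2n$; (5) $\|\mathbf{1}_0\|_1=2-\dfrac2n$; (6) $\mathbf{1}_0$ is not a unit in $F_0^1(G)$ when $n>2$; (7) $F_0^1(G)$ has no contractive approximate identity and cannot be nondegenerately represented on any Banach space when $n>2$.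
   Context: For a finite group $G$ with identity $1_G$: $\ell^1(G)$ is the algebra of functions $a\colon G\to\mathbb{C}$ with convolution product $(ab)(g)=\sum_{h\in G}a(h)b(h^{-1}g)$ and norm $\|a\|_1=\sum_g|a(g)|$. $\delta_g$ is the indicator function of $\{g\}$ and $\Delta_g=\delta_g-\delta_{1_G}$. Let $\iota_0(a)=\sum_{g\in G}a(g)$. Then $\ell_0^1(G)=\{a\in\ell^1(G):\iota_0(a)=0\}$ and $\mathbb{C}_0[G]=\{a\in C_c(G):\iota_0(a)=0\}$, where $C_c(G)$ is the space of finitely supported functions. For $p\in[1,\infty)$, $\lambda_p\colon\ell^1(G)\to\mathcal{L}(\ell^p(G))$ is $\lambda_p(a)b=ab$ (convolution). Since $G$ is finite (hence amenable), the norm $\|\cdot\|_{F^p(G)}$ of the full group $L^p$-operator algebra, defined as the supremum of $\|\pi(a)\|$ over nondegenerate contractive representations $\pi$ of $\ell^1(G)$ on $L^p$-spaces, coincides (known) with $\|a\|_{F^p(G)}=\|\lambda_p(a)\|_{\mathcal{L}(\ell^p(G))}$. $F_0^p(G)$ is the completion of $\ell_0^1(G)$ in the norm $\|\cdot\|_{F^p(G)}$, i.e. the closure of $\lambda_p(\ell_0^1(G))$ in $\mathcal{L}(\ell^p(G))$; elements of $\ell_0^1(G)$ are identified with their images. For $p=1$, $\|\cdot\|_{F^1(G)}=\|\cdot\|_1$. An identity element of a Banach algebra $A$ is $1_A\in A$ with $1_Aa=a=a1_A$ for all $a\in A$; it is called a unit if $\|1_A\|=1$. A contractive approximate identity is a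 net $(e_\lambda)$ with $\|e_\lambda\|\le 1$ and $ae_\lambda\to a$, $e_\lambda a\to a$ in norm for all $a\in A$. ''$A$ can be nondegenerately represented on a Banach space $E$'' means there is an isometric algebra homomorphism $\pi\colon A\to\mathcal{L}(E)$ with $\operatorname{span}\{\pi(a)\xi : a\in A,\xi\in E\}$ dense in $E$. *)

(* Defs.v *)
From HB Require Import structures.
From mathcomp Require Import all_boot all_order all_algebra all_fingroup.
From mathcomp Require Import complex.
From mathcomp Require Import all_classical all_reals all_analysis.

Set Implicit Arguments.
Unset Strict Implicit.
Unset Printing Implicit Defensive.

Import Order.TTheory GRing.Theory Num.Theory.
Import numFieldNormedType.Exports.

Local Open Scope classical_set_scope.
Local Open Scope ring_scope.

(* The norm of a complex normed space takes its values in R[i] (as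
   nonnegative reals); rnorm is the same norm, valued in R. *)
Definition rnorm (R : realType) (V : normedZmodType R[i]) (x : V) : R :=
  complex.Re `|x|.

Section BanachAlgebras.
Variable R : realType.

(* MathComp has no rings without identity, so the product is a field of the
   record. *)
Record banachAlgebra := BanachAlgebra {
  ba_sort :> completeNormedModType R[i];
  ba_mul : ba_sort -> ba_sort -> ba_sort;
  ba_mulA : associative ba_mul;
  ba_mulDl : left_distributive ba_mul +%R;
  ba_mulDr : right_distributive ba_mul +%R;
  ba_scaleAl : forall k x y, ba_mul (k *: x) y = k *: ba_mul x y;
  ba_scaleAr : forall k x y, ba_mul x (k *: y) = k *: ba_mul x y;
  ba_normM : forall x y, `|ba_mul x y| <= `|x| * `|y|
}.

Definition is_identity (A : banachAlgebra) (e : A) : Prop :=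
  forall a : A, ba_mul e a = a /\ ba_mul a e = a.

Definition is_unit (A : banachAlgebra) (e : A) : Prop :=
  is_identity e /\ rnorm e = 1.

Definition directed (I : Type) (le : I -> I -> Prop) : Prop :=
  [/\ inhabited I, forall i, le i i,
      forall i j k, le i j -> le j k -> le i k
    & forall i j, exists k, le i k /\ le j k].

(* For e : I -> T, the statement e @ tails le --> x is net convergence. *)
Definition tails (I : Type) (le : I -> I -> Prop) : set_system I :=
  filter_from [set: I] (fun i => [set k | le i k]).

Definition is_contractive_approx_identity (A : banachAlgebra)
    (I : Type) (le : I -> I -> Prop) (e : I -> A) : Prop :=
  [/\ directed le, forall i, rnorm (e i) <= 1 &
      forall a : A,
        (fun i => ba_mul a (e i)) @ tails le --> a /\
        (fun i => ba_mul (e i) a) @ tails le --> a].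

Definition has_contractive_approx_identity (A : banachAlgebra) : Prop :=
  exists (I : Type) (le : I -> I -> Prop) (e : I -> A),
    is_contractive_approx_identity le e.

Definition opnorm (E : normedModType R[i]) (T : E -> E) : R :=
  sup [set rnorm (T x) | x in [set x | rnorm x <= 1]].

Definition linear_span (E : lmodType R[i]) (S : set E) : set E :=
  [set x | exists (m : nat) (c : 'I_m -> R[i]) (s : 'I_m -> E),
     (forall i, S (s i)) /\ x = \sum_(i < m) c i *: s i].

(* Homomorphisms from the algebra (A, mul) to the bounded operators on E. *)
Definition is_representation (A : lmodType R[i]) (mul : A -> A -> A)
    (E : normedModType R[i]) (pi : A -> {linear E -> E}) : Prop :=
  [/\ forall a, continuous (pi a),
      forall (k : R[i]) a b x, pi (k *: a + b) x = k *: pi a x + pi b x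
    & forall a b x, pi (mul a b) x = pi a (pi b x)].

Definition nondegenerate_rep (A : Type) (E : normedModType R[i])
    (pi : A -> {linear E -> E}) : Prop :=
  dense (linear_span [set y | exists a x, y = pi a x]).

Definition nondegenerately_representable (A : banachAlgebra)
    (E : completeNormedModType R[i]) : Prop :=
  exists pi : A -> {linear E -> E},
    [/\ is_representation (@ba_mul A) pi,
        forall a, opnorm (pi a) = rnorm a & nondegenerate_rep pi].

Definition Lp_function d (T : measurableType d)
    (mu : {measure set T -> \bar R}) (p : R) (f : T -> R[i]) : Prop :=
  [/\ measurable_fun [set: T] (fun t => complex.Re (f t)),
      measurable_fun [set: T] (fun t => complex.Im (f t))
    & (Lnorm mu p%:E (fun t => (rnorm (f t))%:E) < +oo)%E].

(* E is isometrically isomorphic to the complex space L^p(mu) for some mu;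
   rep x is a representative of the class of functions corresponding to x. *)
Definition is_Lp_space (p : R) (E : completeNormedModType R[i]) : Prop :=
  exists (d : measure_display) (T : measurableType d)
    (mu : {measure set T -> \bar R}) (rep : E -> T -> R[i]),
  [/\ forall x, Lp_function mu p (rep x),
      forall (k : R[i]) x y,
        {ae mu, forall t, rep (k *: x + y) t = k * rep x t + rep y t},
      forall x, (rnorm x)%:E = Lnorm mu p%:E (fun t => (rnorm (rep x t))%:E)
    & forall f, Lp_function mu p f ->
        exists x, {ae mu, forall t, rep x t = f t}].

End BanachAlgebras.

Section GroupAlgebra.
Variables (R : realType) (gT : finGroupType).

(* R[i]^o is R[i] as a vector space over itself. *)
Definition ell1 := {ffun gT -> R[i]^o}.

Definition convol (a b : ell1) : ell1 :=
  [ffun g => \sum_(h : gT) a h * b (h^-1 * g)%g].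

Definition ell1_norm (a : ell1) : R := \sum_(g : gT) rnorm (a g : R[i]).

Definition delta (g : gT) : ell1 := [ffun h => (h == g)%:R].
Definition Delta (g : gT) : ell1 := delta g - delta 1%g.

Definition iota0 (a : ell1) : R[i]^o := \sum_(g : gT) a g.

Fact iota0_is_linear : linear iota0.
Proof.
move=> k a b; rewrite /iota0 scaler_sumr -big_split.
by apply: eq_bigr => g _; rewrite !ffunE.
Qed.
HB.instance Definition _ :=
  GRing.isLinear.Build R[i] ell1 R[i]^o *:%R iota0 iota0_is_linear.

Definition ell10 : {vspace ell1} := lker (linfun iota0).

Lemma mem_ell10 (a : ell1) : (a \in ell10) = (iota0 a == 0).
Proof. by rewrite memv_ker lfunE. Qed.

(* C_0[G]; the finite-support condition is automatic since gT is finite. *)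
Definition Cfin0 : set ell1 :=
  [set a : ell1 | finite_set [set g | a g != 0] /\ iota0 a = 0].

Definition one0 : ell1 := - (#|gT|%:R^-1 : R[i]) *: \sum_(g : gT) Delta g.

Lemma iota0_convol (a b : ell1) : iota0 (convol a b) = iota0 a * iota0 b.
Proof.
rewrite /iota0; under eq_bigr do rewrite ffunE.
rewrite exchange_big mulr_suml; apply: eq_bigr => h _ /=.
rewrite -mulr_sumr; congr (_ * _).
by rewrite [RHS](reindex_inj (mulgI h^-1%g)).
Qed.

Lemma convol_ell10 (a b : ell1) :
  a \in ell10 -> b \in ell10 -> convol a b \in ell10.
Proof. by rewrite !mem_ell10 iota0_convol => /eqP -> _; rewrite mul0r. Qed.

(* By convol_ell10, the projection vsproj acts here as the identity. *)
Definition convol0 (a b : subvs_of ell10) : subvs_of ell10 :=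
  vsproj ell10 (convol (vsval a) (vsval b)).

Definition normFp (p : R) (a : ell1) : R :=
  sup [set r : R | exists (E : completeNormedModType R[i])
         (pi : ell1 -> {linear E -> E}),
       [/\ is_Lp_space p E, is_representation convol pi,
           forall b, opnorm (pi b) <= ell1_norm b, nondegenerate_rep pi
         & r = opnorm (pi a)]].

(* A, with the embedding j, is the Banach algebra completion of ell10 for
   the norm normFp p. *)
Definition is_F0p (p : R) (A : banachAlgebra R)
    (j : {linear subvs_of ell10 -> A}) : Prop :=
  [/\ forall a b, j (convol0 a b) = ba_mul (j a) (j b),
      forall a, rnorm (j a) = normFp p (vsval a)
    & dense (range j)].

End GroupAlgebra.

(* Main.v *)
(* On the augmentation ideal, convolution with the sum of all point masses is
   zero, so delta_1 minus the average of the group is an identity there.  The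
   full norm lies between the l^p norm of a function (apply the regular
   representation on l^p(G) to delta_1) and its l^1 norm, which gives the bounds
   on the norm of the identity, and shows that the ideal is already complete, so
   that it coincides with any of its completions.  For p = 1 the two bounds
   agree, and the identity has norm 2 - 2/n > 1 when n > 2.  A contractive
   approximate identity would converge to the identity, and an isometric
   nondegenerate representation would send it to the identity operator; both
   force norm at most 1. *)
Require Import Defs.
From HB Require Import structures.
From mathcomp Require Import all_boot all_order all_algebra all_fingroup.
From mathcomp Require Import complex.
From mathcomp Require Import all_classical all_reals all_analysis.
From mathcomp Require Import ring.
Set Implicit Arguments.
Unset Strict Implicit.
Unset Printing Implicit Defensive.
Import Order.TTheory GRing.Theory Num.Theory.
Import numFieldNormedType.Exports.
Local Open Scope classical_set_scope.
Local Open Scope ring_scope.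

(** * Real-valued norms and complete coordinate spaces *)

Section RealNorm.
Variables (R : realType) (V : normedZmodType (R[i] : numDomainType)).
Implicit Types x y : V.

Lemma rnormE x : `|x| = (rnorm x)%:C%C.
Proof. by rewrite /rnorm RRe_real// normr_real. Qed.

Lemma rnorm_ge0 x : 0 <= rnorm x.
Proof. by rewrite -ler0c -rnormE. Qed.

Lemma ler_rnormD x y : rnorm (x + y) <= rnorm x + rnorm y.
Proof. by rewrite -lecR rmorphD/= -!rnormE ler_normD. Qed.

Lemma rnorm0 : rnorm (0 : V) = 0.
Proof. by rewrite /rnorm normr0. Qed.

Lemma rnormN x : rnorm (- x) = rnorm x.
Proof. by rewrite /rnorm normrN. Qed.

Lemma rnorm_eq0 x : rnorm x = 0 -> x = 0.
Proof. by move=> x0; apply/eqP; rewrite -normr_eq0 rnormE x0. Qed.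

Lemma ler_rnorm_sum (I : Type) (r : seq I) (F : I -> V) :
  rnorm (\sum_(i <- r) F i) <= \sum_(i <- r) rnorm (F i).
Proof.
elim/big_rec2: _ => [|i y x _ xy]; first by rewrite rnorm0.
by rewrite (le_trans (ler_rnormD _ _))// lerD2l.
Qed.

End RealNorm.

Section ComplexRealNorm.
Variable R : realType.
Implicit Types z w : R[i].

Lemma rnormM z w : rnorm (z * w) = rnorm z * rnorm w.
Proof. by apply: (@complexI R); rewrite rmorphM/= -!rnormE normrM. Qed.

Lemma rnorm_real (r : R) : rnorm (r%:C%C : R[i]) = `|r|.
Proof. by rewrite /rnorm normc_def /= expr0n/= addr0 sqrtr_sqr. Qed.

Lemma rnorm_nat (k : nat) : rnorm (k%:R : R[i]) = k%:R.
Proof. by rewrite -(rmorph_nat (real_complex R)) rnorm_real normr_nat. Qed.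

Lemma rnorm1 : rnorm (1 : R[i]) = 1.
Proof. exact: rnorm_nat 1. Qed.

Lemma Re_le_rnorm z : `|complex.Re z| <= rnorm z.
Proof. by rewrite -lecR -rnormE normc_ge_Re. Qed.

Lemma Im_le_rnorm z : `|complex.Im z| <= rnorm z.
Proof.
case: z => a b; rewrite /rnorm normc_def /= -sqrtr_sqr.
by rewrite ler_sqrt ?lerDr ?sqr_ge0 ?addr_ge0 ?sqr_ge0.
Qed.

Lemma rnorm_le_Re_Im z : rnorm z <= `|complex.Re z| + `|complex.Im z|.
Proof.
rewrite [z in leLHS]complexE (le_trans (ler_rnormD _ _))//.
rewrite rnormM !rnorm_real lerD2l ler_piMl//.
by rewrite /rnorm normc_def /= expr0n expr1n/= add0r sqrtr1.
Qed.

Lemma rnormZ (V : normedModType R[i]) (k : R[i]) (x : V) :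
  rnorm (k *: x) = rnorm k * rnorm x.
Proof. by apply: (@complexI R); rewrite rmorphM/= -!rnormE normrZ. Qed.

End ComplexRealNorm.

(** * Operator norms as suprema over the closed unit ball *)

Section Opnorm.
Variables (R : realType) (E : normedModType R[i]).
Implicit Types T : {linear E -> E}.

Lemma opnorm_set_nonempty (T : E -> E) :
  [set rnorm (T x) | x in [set x | rnorm x <= 1]] !=set0.
Proof. by exists (rnorm (T 0)), 0; rewrite //= rnorm0. Qed.

Lemma opnorm_le (T : E -> E) (c : R) :
  0 <= c -> (forall x, rnorm (T x) <= c * rnorm x) -> opnorm T <= c.
Proof.
move=> c0 Tc; apply: ge_sup; first exact: opnorm_set_nonempty.
by move=> _ [x /= x1 <-]; rewrite (le_trans (Tc x))// ler_piMr.
Qed.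

Lemma opnorm_ge0 (T : E -> E) : 0 <= opnorm T.
Proof.
rewrite /opnorm; set S := (X in sup X).
have [bS|] := pselect (has_ubound S); last first.
  (* An arbitrary map may be unbounded on the unit ball; [sup] then takes its default value 0. *)
  by move=> nb; rewrite sup_out// => -[].
have [r Sr] := opnorm_set_nonempty T; rewrite -/S in Sr.
apply: (@le_trans _ _ r); last exact: ub_le_sup.
by case: Sr => x _ <-; exact: rnorm_ge0.
Qed.

(** Continuity bounds [T] on the unit ball, so the supremum there is a genuine upper bound;
    rescaling a nonzero [x] to norm one carries the bound to all vectors. *)
Lemma le_opnorm T x : continuous T -> rnorm (T x) <= opnorm T * rnorm x.
Proof.
move=> /linear_bounded_continuous/linear_boundedP/pinfty_ex_gt0[M M0 TM].
have ubT : has_ubound [set rnorm (T x) | x in [set x | rnorm x <= 1]].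
  exists (complex.Re M) => _ [y /= y1 <-]; rewrite -lecR -rnormE.
  rewrite [leRHS]RRe_real ?gtr0_real// (le_trans (TM y))// ler_piMr ?(ltW M0)// rnormE.
  by rewrite -(rmorph1 (real_complex R)) lecR.
have [->|x0] := eqVneq x 0; first by rewrite linear0 !rnorm0 mulr0.
have nx0 : 0 < rnorm x.
  rewrite lt_def rnorm_ge0 andbT; apply: contra_neq x0; exact: rnorm_eq0.
rewrite -ler_pdivrMr//; apply: ub_le_sup => //.
exists ((rnorm x)^-1%:C%C *: x) => /=.
  by rewrite rnormZ rnorm_real gtr0_norm ?invr_gt0// mulVf ?gt_eqF.
by rewrite linearZ/= rnormZ rnorm_real gtr0_norm ?invr_gt0// mulrC.
Qed.

End Opnorm.

Lemma rnorm_bounded_continuous (R : realType) (E : normedModType R[i])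
    (T : {linear E -> E}) (c : R) :
  (forall x, rnorm (T x) <= c * rnorm x) -> continuous T.
Proof.
move=> Tc; apply/linear_bounded_continuous/linear_boundedP.
near=> r => x; rewrite !rnormE (@le_trans _ _ (c * rnorm x)%:C%C) ?lecR//.
rewrite rmorphM/= ler_wpM2r ?ler0c ?rnorm_ge0//; near: r.
by apply: nbhs_pinfty_ge; rewrite complex_real.
Unshelve. all: by end_near. Qed.

(* Norms that dominate the coordinates of a finite spanning family: convergence
   is then coordinatewise, so completeness needs no compactness argument. *)
Record coordNorm (R : realType) (V : lmodType R[i]) (I : finType) := CoordNorm {
  cn_norm :> V -> R;
  cn_basis : I -> V;
  cn_coord : I -> V -> R[i];
  cn_normD : forall x y, cn_norm (x + y) <= cn_norm x + cn_norm y;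
  cn_normZ : forall (k : R[i]) x, cn_norm (k *: x) = rnorm k * cn_norm x;
  cn_coordB : forall i x y, cn_coord i (x - y) = cn_coord i x - cn_coord i y;
  cn_expand : forall x, x = \sum_i cn_coord i x *: cn_basis i;
  cn_bound : forall i x, rnorm (cn_coord i x) <= cn_norm x }.

(** * Complete normed spaces built from coordinate norms *)

Section CoordNormedSpace.
Variables (R : realType) (V : lmodType R[i]) (I : finType).
Variable N : coordNorm V I.

(** An alias of [V] indexed by the norm, so that the normed and complete structures below attach to
    one chosen norm. *)
Definition cnormed (M : coordNorm V I) : Type := V.

HB.instance Definition _ := GRing.Lmodule.copy (cnormed N) V.

Let normD (x y : cnormed N) : (N (x + y))%:C%C <= (N x)%:C%C + (N y)%:C%C.
Proof. by rewrite -rmorphD lecR; exact: cn_normD. Qed.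

Let normZ (k : R[i]) (x : cnormed N) : (N (k *: x))%:C%C = `|k| * (N x)%:C%C.
Proof. by rewrite (cn_normZ N) rmorphM/= -rnormE. Qed.

Let norm_eq0 (x : cnormed N) : (N x)%:C%C = 0 -> x = 0.
Proof.
move=> [Nx0]; rewrite (cn_expand N x) big1// => i _.
have := cn_bound N i x; rewrite Nx0 => xi0.
by rewrite (rnorm_eq0 (le_anti (introT andP (conj xi0 (rnorm_ge0 _))))) scale0r.
Qed.

HB.instance Definition _ := Lmodule_isNormed.Build R[i] (cnormed N)
  normD normZ norm_eq0.

Lemma rnorm_cnormed (x : cnormed N) : rnorm x = N x.
Proof. by []. Qed.

(** A 1-Lipschitz function sends a Cauchy filter to a Cauchy filter, which converges because [R] is
    complete. *)
Let lipschitz_cvg (f : cnormed N -> R) (F : set_system (cnormed N)) :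
  (forall x y, `|f x - f y| <= N (x - y)) ->
  ProperFilter F -> cauchy F -> cvg (f @ F).
Proof.
move=> fN FF /cauchyP Fc; apply: cauchy_cvg; apply/cauchyP => e e0.
have [|x xF] := Fc (e%:C%C : R[i]); first by rewrite ltcR.
exists (f x); rewrite /= nbhs_filterE; apply: (@filterS _ F _ _ _ _ xF) => y /=.
rewrite -!ball_normE /= /ball_/= (rnormE (x - y)) ltcR; exact: le_lt_trans.
Qed.

(** Real and imaginary parts of the coordinates are 1-Lipschitz, hence converge along [F]; the limit
    is the vector [l] assembled from these limits. *)
Let cnormed_complete (F : set_system (cnormed N)) :
  ProperFilter F -> cauchy F -> cvg F.
Proof.
move=> FF Fc.
pose re i (x : cnormed N) : R := complex.Re (cn_coord N i x).
pose im i (x : cnormed N) : R := complex.Im (cn_coord N i x).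
have cvre i : cvg (re i @ F).
  apply: lipschitz_cvg => // x y; rewrite -raddfB -cn_coordB.
  exact: le_trans (Re_le_rnorm _) (cn_bound _ _ _).
have cvim i : cvg (im i @ F).
  apply: lipschitz_cvg => // x y; rewrite -raddfB -cn_coordB.
  exact: le_trans (Im_le_rnorm _) (cn_bound _ _ _).
pose r i : R := lim (re i @ F); pose s i : R := lim (im i @ F).
pose l : cnormed N := \sum_i (r i +i* s i)%C *: cn_basis N i.
(* [g] dominates the distance to [l] and is a finite sum of terms tending to 0 along [F]. *)
pose g (x : cnormed N) : R :=
  \sum_i (`|r i - re i x| + `|s i - im i x|) * N (cn_basis N i).
have g0 : g @ F --> (0 : R).
  rewrite [X in _ --> X](_ : 0 = \sum_i (`|r i - r i| + `|s i - s i|) *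
    N (cn_basis N i)); last by rewrite big1// => i _; rewrite !subrr normr0 addr0 mul0r.
  apply: cvg_big => [|i _]; first exact: add_continuous.
  apply: cvgMr_tmp; apply: cvgD; apply: cvg_norm; apply: cvgB;
    [exact: cvg_cst|exact: cvre|exact: cvg_cst|exact: cvim].
have gN x : N (l - x) <= g x.
  rewrite {1}[x](cn_expand N) -sumrB /g.
  rewrite (le_trans (ler_rnorm_sum (V := cnormed N) _ _))//.
  apply: ler_sum => i _; rewrite -scalerBl rnorm_cnormed (cn_normZ N).
  rewrite ler_wpM2r//; first by rewrite -rnorm_cnormed rnorm_ge0.
  rewrite (le_trans (rnorm_le_Re_Im _))// /re /im.
  by case: (cn_coord N i x).
apply/cvg_ex; exists l; apply/(@cvgrPdist_lt _ (cnormed N)) => e e0.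
have eE : (complex.Re e)%:C%C = e by rewrite RRe_real ?gtr0_real.
have /(_ _ (complex.Re e)) := @cvgr0_norm_lt _ _ _ _ _ g g0.
rewrite -ltcR eE => /(_ e0); apply: filterS => x gx.
rewrite rnormE rnorm_cnormed -eE ltcR (le_lt_trans _ gx)//.
exact: le_trans (gN x) (ler_norm _).
Qed.

HB.instance Definition _ := Uniform_isComplete.Build (cnormed N) cnormed_complete.

End CoordNormedSpace.

(** * The space l^p(G) *)

Section DiscreteGroup.
Variables (R : realType) (gT : finGroupType).

(** An alias of the carrier, made a measurable space by taking all subsets as measurable. *)
Definition discrete_group : Type := gT.

HB.instance Definition _ := Choice.copy discrete_group gT.
HB.instance Definition _ := isPointed.Build discrete_group (1%g : gT).
HB.instance Definition _ := @isMeasurable.Build default_measure_display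
  discrete_group discrete_measurable discrete_measurable0
  discrete_measurableC discrete_measurableU.

(* The counting measure, written as a finite sum of point masses so that
   integrals against it reduce to finite sums. *)
Definition group_counting : {measure set discrete_group -> \bar R} :=
  msum (fun k => \d_(nth (1%g : gT) (enum gT) k : discrete_group)) #|gT|.

Lemma measurable_discrete_group d (T : measurableType d) (f : discrete_group -> T) :
  measurable_fun [set: discrete_group] f.
Proof. by []. Qed.

Lemma integral_group_counting (f : gT -> R) : (forall g, 0 <= f g) ->
  (\int[group_counting]_x (f x)%:E = (\sum_(g : gT) f g)%:E)%E.
Proof.
move=> f0; rewrite ge0_integral_measure_sum//; last by move=> x _; rewrite lee_fin.
under eq_bigr do rewrite integral_dirac// diracT mul1e.
rewrite sumEFin; congr EFin.
by rewrite -[in RHS]big_enum (big_nth (1%g : gT)) big_mkord -cardE.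
Qed.

End DiscreteGroup.

(** * The l^p norm as a coordinate norm *)

Section LpNorm.
Variables (R : realType) (gT : finGroupType) (p : R).
Hypothesis p1 : 1 <= p.
Local Notation V := (ell1 R gT).
Implicit Types (x y : V) (f : gT -> R).

Let p_gt0 : 0 < p. Proof. exact: lt_le_trans ltr01 p1. Qed.

Let ip_ge0 : 0 <= p^-1. Proof. by rewrite invr_ge0 ltW. Qed.

Let powRV (t : R) : 0 <= t -> (t `^ p) `^ p^-1 = t.
Proof. by move=> t0; rewrite -powRrM mulfV ?gt_eqF// powRr1. Qed.

Definition lp_norm x : R := (\sum_(g : gT) rnorm (x g : R[i]) `^ p) `^ p^-1.

Lemma Lnorm_group_counting f :
  Lnorm (group_counting R gT) p%:E (EFin \o f) =
  ((\sum_(g : gT) `|f g| `^ p) `^ p^-1)%:E.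
Proof.
rewrite unlock /=.
by rewrite (integral_group_counting (f := fun g => `|f g| `^ p))// => g; exact: powR_ge0.
Qed.

Lemma Lnorm_lp_norm x :
  Lnorm (group_counting R gT) p%:E (fun t => (rnorm (x t : R[i]))%:E) =
  (lp_norm x)%:E.
Proof.
rewrite (Lnorm_group_counting (fun t => rnorm (x t : R[i]))); congr ((_ `^ _)%:E).
by apply: eq_bigr => g _; rewrite ger0_norm// rnorm_ge0.
Qed.

(** Minkowski's inequality for the counting measure is applied to the moduli of [x] and [y]; the
    pointwise triangle inequality and monotonicity of powers do the rest. *)
Lemma ler_lp_normD x y : lp_norm (x + y) <= lp_norm x + lp_norm y.
Proof.
have := @minkowski_EFin _ _ R (group_counting R gT)
  (fun t => rnorm (x t : R[i])) (fun t => rnorm (y t : R[i])) p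
  (measurable_discrete_group _) (measurable_discrete_group _) p1.
rewrite Lnorm_group_counting [X in (_ <= X + _)%E](Lnorm_lp_norm x).
rewrite [X in (_ <= _ + X)%E](Lnorm_lp_norm y) -EFinD lee_fin; apply: le_trans.
rewrite ge0_ler_powR ?nnegrE ?sumr_ge0//; try by move=> *; exact: powR_ge0.
apply: ler_sum => g _.
rewrite ge0_ler_powR ?nnegrE ?rnorm_ge0 ?normr_ge0 ?(ltW p_gt0)// ffunE.
exact: le_trans (ler_rnormD _ _) (ler_norm _).
Qed.

Lemma lp_normZ (k : R[i]) x : lp_norm (k *: x) = rnorm k * lp_norm x.
Proof.
rewrite /lp_norm -[in RHS](powRV (rnorm_ge0 k)) -powRM ?powR_ge0 ?sumr_ge0//;
  last by move=> *; exact: powR_ge0.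
rewrite mulr_sumr; congr (_ `^ _); apply: eq_bigr => g _.
by rewrite ffunE rnormM powRM ?rnorm_ge0.
Qed.

Lemma rnorm_le_lp_norm (g : gT) x : rnorm (x g : R[i]) <= lp_norm x.
Proof.
rewrite -[leLHS](powRV (rnorm_ge0 _)) ge0_ler_powR ?nnegrE ?powR_ge0 ?sumr_ge0//;
  try by move=> *; exact: powR_ge0.
rewrite (bigD1 g)//= lerDl sumr_ge0// => *; exact: powR_ge0.
Qed.

Lemma ell1_expand x : x = \sum_(g : gT) (x g : R[i]) *: delta R g.
Proof.
apply/ffunP => h; rewrite sum_ffunE (bigD1 h)//= 2!ffunE eqxx /GRing.scale/= mulr1.
rewrite big1 ?addr0//.
by move=> g /negbTE gh; rewrite !ffunE eq_sym gh scaler0.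
Qed.

Lemma ell1_coordB (g : gT) x y : (x - y) g = x g - y g.
Proof. by rewrite !ffunE. Qed.

Lemma lp_norm_delta (h : gT) : lp_norm (delta R h) = 1.
Proof.
have dE g : rnorm (delta R h g : R[i]) = (g == h)%:R by rewrite ffunE rnorm_nat.
rewrite /lp_norm (bigD1 h)//= dE eqxx big1 => [|g /negbTE gh].
  by rewrite addr0 !powR1.
by rewrite dE gh powR0// gt_eqF.
Qed.

Definition lp_coordNorm : coordNorm V gT :=
  @CoordNorm R V gT lp_norm (@delta R gT) (fun g x => x g) ler_lp_normD lp_normZ
    ell1_coordB ell1_expand rnorm_le_lp_norm.

End LpNorm.

(** * The regular representation and the full norm *)

Section Convolution.
Variables (R : realType) (gT : finGroupType).
Local Notation V := (ell1 R gT).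
Implicit Types (a b c x y : V) (g h : gT).

Definition translate h x : V := [ffun g => x (h^-1 * g)%g].

(** Convolution becomes a combination of translations, which are isometries of l^p; this is the
    source of the bound by [ell1_norm]. *)
Lemma convol_translate a x : convol a x = \sum_(h : gT) (a h : R[i]) *: translate h x.
Proof.
by apply/ffunP => g; rewrite ffunE sum_ffunE; apply: eq_bigr => h _; rewrite !ffunE.
Qed.

Lemma convolDl a b x : convol (a + b) x = convol a x + convol b x.
Proof.
apply/ffunP => g; rewrite !ffunE -big_split/=.
by apply: eq_bigr => h _; rewrite !ffunE mulrDl.
Qed.

Lemma convolDr a x y : convol a (x + y) = convol a x + convol a y.
Proof.
apply/ffunP => g; rewrite !ffunE -big_split/=.
by apply: eq_bigr => h _; rewrite !ffunE mulrDr.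
Qed.

Lemma convolZl (k : R[i]) a x : convol (k *: a) x = k *: convol a x.
Proof.
apply/ffunP => g; rewrite !ffunE scaler_sumr.
by apply: eq_bigr => h _; rewrite !ffunE /GRing.scale/= mulrA.
Qed.

Lemma convolZr (k : R[i]) a x : convol a (k *: x) = k *: convol a x.
Proof.
apply/ffunP => g; rewrite !ffunE scaler_sumr.
by apply: eq_bigr => h _; rewrite !ffunE /GRing.scale/= mulrCA.
Qed.

Lemma convolA : associative (@convol R gT).
Proof.
move=> a b c; apply/ffunP => g; rewrite !ffunE.
under eq_bigr do rewrite ffunE mulr_sumr.
under [RHS]eq_bigr do rewrite ffunE mulr_suml.
rewrite [RHS]exchange_big/=; apply: eq_bigr => h _.
(* The substitution [k] to [h * k] turns the inner factor [b (h^-1 * k)] into [b k]. *)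
rewrite [RHS](reindex_inj (mulgI h)); apply: eq_bigr => k _ /=.
by rewrite mulKg invMg mulgA mulrA.
Qed.

Lemma convol_delta1l x : convol (delta R (1%g : gT)) x = x.
Proof.
apply/ffunP => g; rewrite ffunE (bigD1 1%g)//= ffunE eqxx mul1r invg1 mul1g.
by rewrite big1 ?addr0// => h /negbTE h1; rewrite ffunE h1 mul0r.
Qed.

Lemma convol_delta1r x : convol x (delta R (1%g : gT)) = x.
Proof.
apply/ffunP => g; rewrite ffunE (bigD1 g)//= ffunE mulVg eqxx mulr1.
rewrite big1 ?addr0// => h /negbTE hg; rewrite ffunE.
by rewrite -(inj_eq (mulgI h)) mulKVg mulg1 eq_sym hg mulr0.
Qed.

End Convolution.

Section RegularRepresentation.
Variables (R : realType) (gT : finGroupType) (p : R) (p1 : 1 <= p).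
Local Notation V := (ell1 R gT).

Definition lp_space : completeNormedModType R[i] := cnormed (lp_coordNorm gT p1).

(** Each vector is its own representative for the counting measure, so the almost-everywhere
    conditions hold at every point. *)
Lemma is_Lp_space_lp_space : is_Lp_space p lp_space.
Proof.
exists default_measure_display, (discrete_group gT), (group_counting R gT),
  (fun (x : lp_space) (t : discrete_group gT) => (x : V) t).
split.
- by move=> x; split=> //; rewrite Lnorm_lp_norm ltry.
- by move=> k x y; apply/aeW => t; rewrite !ffunE.
- by move=> x; rewrite Lnorm_lp_norm.
- move=> f _; exists ([ffun g => f g] : V); apply/aeW => t.
  by rewrite ffunE.
Qed.

Lemma lp_norm_translate (h : gT) (x : V) : lp_norm p (translate h x) = lp_norm p x.
Proof.
rewrite /lp_norm [in RHS](reindex_inj (mulgI h^-1%g)).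
by congr (_ `^ _); apply: eq_bigr => g _; rewrite ffunE.
Qed.

Definition regular_op (a : V) : lp_space -> lp_space := convol a.

Let regular_op_linear a : linear (regular_op a).
Proof. by move=> k x y; rewrite /regular_op convolDr convolZr. Qed.

HB.instance Definition _ (a : V) :=
  GRing.isLinear.Build R[i] lp_space lp_space *:%R (regular_op a)
    (regular_op_linear a).

Definition regular_rep (a : V) : {linear lp_space -> lp_space} := regular_op a.

Lemma regular_rep_bound (a : V) (x : lp_space) :
  rnorm (regular_rep a x) <= ell1_norm a * rnorm x.
Proof.
rewrite /= /regular_op convol_translate mulr_suml.
apply: (le_trans (ler_rnorm_sum (V := lp_space) _ _)).
apply: ler_sum => h _; rewrite (rnormZ (V := lp_space)) !rnorm_cnormed.
by rewrite /= lp_norm_translate.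
Qed.

Lemma regular_rep_continuous (a : V) : continuous (regular_rep a).
Proof. exact: rnorm_bounded_continuous (@regular_rep_bound a). Qed.

Lemma ell1_norm_ge0 (a : V) : 0 <= ell1_norm a.
Proof. by apply: sumr_ge0 => g _; exact: rnorm_ge0. Qed.

Lemma regular_rep_representation : is_representation (@convol R gT) regular_rep.
Proof.
split; first exact: regular_rep_continuous.
- by move=> k a b x; rewrite /= /regular_op convolDl convolZl.
- by move=> a b x; rewrite /= /regular_op convolA.
Qed.

Lemma regular_rep_contractive (a : V) : opnorm (regular_rep a) <= ell1_norm a.
Proof. by apply: opnorm_le; [exact: ell1_norm_ge0|exact: regular_rep_bound]. Qed.

Lemma regular_rep_nondegenerate : nondegenerate_rep regular_rep.
Proof.
move=> O [x Ox] _; exists x; split => //.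
(* Every vector already lies in the span, since [delta R 1] acts as the identity operator. *)
exists 1%N, (fun=> 1), (fun=> x); split; last by rewrite big_ord1 scale1r.
by move=> _; exists (delta R (1%g : gT)), x; rewrite /= /regular_op convol_delta1l.
Qed.

End RegularRepresentation.

(** * The full L^p-operator norm and its algebra-norm properties *)

Section FullNorm.
Variables (R : realType) (gT : finGroupType) (p : R) (p1 : 1 <= p).
Local Notation V := (ell1 R gT).
Implicit Types a b : V.

Let contractive_rep (E : completeNormedModType R[i]) (pi : V -> {linear E -> E}) :=
  [/\ is_Lp_space p E, is_representation (@convol R gT) pi,
      forall b, opnorm (pi b) <= ell1_norm b & nondegenerate_rep pi].

Let regular_contractive : contractive_rep (@regular_rep R gT p p1).
Proof.
split; [exact: is_Lp_space_lp_space|exact: regular_rep_representation| |].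
- exact: regular_rep_contractive.
- exact: regular_rep_nondegenerate.
Qed.

(** Contractivity makes [ell1_norm a] an upper bound of the defining set, so its [sup] is not the
    default value. *)
Let le_normFp (E : completeNormedModType R[i]) (pi : V -> {linear E -> E}) a :
  contractive_rep pi -> opnorm (pi a) <= normFp p a.
Proof.
move=> [LpE reppi cpi ndpi]; apply: ub_le_sup; last by exists E, pi.
by exists (ell1_norm a) => _ [F [rho [_ _ crho _ ->]]].
Qed.

(** The regular representation makes the defining set nonempty, as the least-upper-bound property of
    [sup] requires. *)
Let normFp_le a (c : R) :
  (forall (E : completeNormedModType R[i]) (pi : V -> {linear E -> E}),
     contractive_rep pi -> opnorm (pi a) <= c) -> normFp p a <= c.
Proof.
move=> ac; apply: ge_sup.
  exists (opnorm (@regular_rep R gT p p1 a)), (lp_space gT p1), (@regular_rep R gT p p1).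
  by have [] := regular_contractive.
by move=> _ [E [pi [LpE reppi cpi ndpi ->]]]; exact: ac.
Qed.

Lemma normFp_ge0 a : 0 <= normFp p a.
Proof. exact: le_trans (opnorm_ge0 _) (le_normFp a regular_contractive). Qed.

Lemma normFp_le_ell1 a : normFp p a <= ell1_norm a.
Proof. by apply: normFp_le => E pi []. Qed.

(* The regular representation maps the unit vector [delta 1] to [a]. *)
Lemma lp_norm_le_normFp a : lp_norm p a <= normFp p a.
Proof.
apply: le_trans (le_normFp a regular_contractive).
have := @le_opnorm _ _ (@regular_rep R gT p p1 a)
  (delta R (1%g : gT) : lp_space gT p1) (@regular_rep_continuous _ _ _ _ a).
rewrite !rnorm_cnormed /= /regular_op convol_delta1r lp_norm_delta ?mulr1//.
Qed.

Lemma normFpD a b : normFp p (a + b) <= normFp p a + normFp p b.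
Proof.
apply: normFp_le => E pi rpi; have [_ [cpi lpi mpi] _ _] := rpi.
apply: opnorm_le => [|x]; first by rewrite addr_ge0 ?normFp_ge0.
rewrite -[a]scale1r lpi !scale1r mulrDl (le_trans (ler_rnormD _ _))//.
by apply: lerD; rewrite (le_trans (le_opnorm _ (cpi _)))// ler_wpM2r ?rnorm_ge0// le_normFp.
Qed.

Lemma normFpM a b : normFp p (convol a b) <= normFp p a * normFp p b.
Proof.
apply: normFp_le => E pi rpi; have [_ [cpi lpi mpi] _ _] := rpi.
apply: opnorm_le => [|x]; first by rewrite mulr_ge0 ?normFp_ge0.
rewrite mpi (le_trans (le_opnorm _ (cpi _)))// -mulrA.
rewrite ler_pM ?opnorm_ge0 ?rnorm_ge0 ?le_normFp//.
by rewrite (le_trans (le_opnorm _ (cpi _)))// ler_wpM2r ?rnorm_ge0// le_normFp.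
Qed.

Let normFpZ_le (k : R[i]) a : normFp p (k *: a) <= rnorm k * normFp p a.
Proof.
apply: normFp_le => E pi rpi; have [_ [cpi lpi mpi] _ _] := rpi.
apply: opnorm_le => [|x]; first by rewrite mulr_ge0 ?normFp_ge0 ?rnorm_ge0.
(* A representation is linear in the form [k *: a + b]; taking [k = -1] and [a = b = 0] yields the
   value at 0. *)
have pi0 : pi 0 x = 0 by have := lpi (-1) 0 0 x; rewrite scaler0 addr0 scaleN1r addNr.
rewrite -[k *: a]addr0 lpi pi0 addr0 rnormZ -mulrA ler_wpM2l ?rnorm_ge0//.
by rewrite (le_trans (le_opnorm _ (cpi _)))// ler_wpM2r ?rnorm_ge0// le_normFp.
Qed.

(** The reverse inequality is the forward one applied to [k^-1] and [k *: a]. *)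
Lemma normFpZ (k : R[i]) a : normFp p (k *: a) = rnorm k * normFp p a.
Proof.
apply/eqP; rewrite eq_le normFpZ_le/=.
have [->|k0] := eqVneq k 0; first by rewrite rnorm0 mul0r normFp_ge0.
have rk0 : 0 < rnorm k.
  by rewrite lt_def rnorm_ge0 andbT; apply: contra_neq k0; exact: rnorm_eq0.
have rkV : rnorm k^-1 = (rnorm k)^-1.
  by apply: (mulIf (lt0r_neq0 rk0)); rewrite -rnormM !mulVf ?rnorm1 ?(lt0r_neq0 rk0).
rewrite -ler_pdivlMl// -rkV.
by have := normFpZ_le k^-1 (k *: a); rewrite scalerA mulVf// scale1r.
Qed.

End FullNorm.

(** * The augmentation ideal *)

Section AugmentationIdeal.
Variables (R : realType) (gT : finGroupType).
Local Notation V := (ell1 R gT).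
Local Notation V0 := (ell10 R gT).
Local Notation n := (#|gT|).
Implicit Types (a b : V) (g h : gT).

Definition all_one : V := \sum_(g : gT) delta R g.

Lemma all_oneE h : all_one h = 1.
Proof.
rewrite sum_ffunE (bigD1 h)//= ffunE eqxx big1 ?addr0// => g /negbTE gh.
by rewrite ffunE eq_sym gh.
Qed.

(** [all_one] is invariant under translation, so only the total mass of [a] survives. *)
Lemma convol_all_one a : convol a all_one = iota0 a *: all_one.
Proof.
apply/ffunP => g; rewrite !ffunE all_oneE /GRing.scale/= mulr1.
by apply: eq_bigr => h _; rewrite all_oneE mulr1.
Qed.

Lemma all_one_convol a : convol all_one a = iota0 a *: all_one.
Proof.
apply/ffunP => g; rewrite !ffunE all_oneE /GRing.scale/= mulr1.
(* The injective map [h] to [h^-1 * g] matches the argument of the second factor in the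
   convolution. *)
rewrite /iota0 [RHS](reindex_inj (inj_comp (mulIg g) (@invg_inj gT)))/=.
by apply: eq_bigr => h _; rewrite all_oneE mul1r.
Qed.

Lemma iota0_delta g : iota0 (delta R g) = 1.
Proof.
rewrite /iota0 (bigD1 g)//= ffunE eqxx big1 ?addr0// => h /negbTE hg.
by rewrite ffunE hg.
Qed.

Lemma Delta_ell10 g : Delta R g \in V0.
Proof. by rewrite mem_ell10 linearB/= !iota0_delta subrr. Qed.

(** Replacing each [delta R g] by [Delta R g] subtracts [iota0 a *: delta R 1], which vanishes on
    the ideal. *)
Lemma ell10_expand a : a \in V0 -> a = \sum_(g : gT) (a g : R[i]) *: Delta R g.
Proof.
rewrite mem_ell10 => /eqP a0; under eq_bigr do rewrite scalerBr.
rewrite sumrB -scaler_suml -ell1_expand.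
by rewrite (_ : \sum_g _ = iota0 a)// a0 scale0r subr0.
Qed.

Lemma ell10_span : V0 = <<[seq Delta R g | g : gT]>>%VS.
Proof.
apply/eqP; rewrite eqEsubv; apply/andP; split; apply/subvP.
  move=> a /ell10_expand ->; apply: memv_suml => g _; apply: memvZ.
  by apply: memv_span; apply/mapP; exists g; rewrite ?mem_enum.
by apply/subvP/span_subvP => _ /mapP[g _ ->]; exact: Delta_ell10.
Qed.

Lemma ell10_Cfin0 : [set` V0] = @Cfin0 R gT.
Proof.
apply/seteqP; split=> a /=; rewrite mem_ell10; last by case=> _ ->.
by move=> /eqP a0; split=> //; exact: finite_finset.
Qed.

(** Rank-nullity: the augmentation takes the value 1 at [delta R 1], so its image is
    one-dimensional. *)
Lemma dim_ell10 : \dim V0 = n.-1.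
Proof.
have f1 : linfun (@iota0 R gT) (delta R 1%g) = 1 by rewrite lfunE/= iota0_delta.
have := limg_ker_dim (linfun (@iota0 R gT)) fullv.
rewrite capfv dimvf /= => nE.
suff lim1 : \dim (limg (linfun (@iota0 R gT))) = 1%N.
  by move: nE; rewrite lim1 addn1 /dim/= muln1 => <-.
apply/eqP; rewrite eqn_leq (leq_trans (dimvS (subvf _))) ?dimvf//=.
rewrite lt0n dimv_eq0; apply/eqP => lim0.
have : linfun (@iota0 R gT) (delta R 1%g) \in limg (linfun (@iota0 R gT)).
  exact: memv_img (memvf _).
by rewrite lim0 f1 memv0 oner_eq0.
Qed.

Lemma nR_neq0 : n%:R != 0 :> R[i].
Proof. by rewrite pnatr_eq0 -lt0n; apply/card_gt0P; exists 1%g. Qed.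

Lemma one0E : one0 R gT = delta R (1%g : gT) - (n%:R^-1 : R[i]) *: all_one.
Proof.
rewrite /one0 /Delta sumrB sumr_const scaleNr scalerBr opprB.
by rewrite -(scaler_nat _ (delta R 1%g)) scalerA mulVf ?nR_neq0// scale1r.
Qed.

Lemma one0_ell10 : one0 R gT \in V0.
Proof.
apply: memvZ; apply: memv_suml => g _; exact: Delta_ell10.
Qed.

Lemma one0_convol a : a \in V0 -> convol (one0 R gT) a = a.
Proof.
rewrite mem_ell10 => /eqP a0.
by rewrite one0E -scaleNr convolDl convolZl all_one_convol a0 scale0r scaler0 addr0
  convol_delta1l.
Qed.

Lemma convol_one0 a : a \in V0 -> convol a (one0 R gT) = a.
Proof.
rewrite mem_ell10 => /eqP a0.
by rewrite one0E -scaleNr convolDr convolZr convol_all_one a0 scale0r scaler0 addr0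
  convol_delta1r.
Qed.

Lemma rnorm_one0 g :
  rnorm (one0 R gT g : R[i]) = (if g == 1%g then n%:R - 1 else 1) / n%:R.
Proof.
have n1 : 1 <= n%:R :> R by rewrite ler1n; apply/card_gt0P; exists 1%g.
have n0 : n%:R != 0 :> R by rewrite gt_eqF// (lt_le_trans ltr01).
rewrite one0E !ffunE all_oneE /GRing.scale/= mulr1.
rewrite -(rmorph_nat (real_complex R) n) -fmorphV.
rewrite -(rmorph_nat (real_complex R) (g == 1%g)) -rmorphB rnorm_real.
case: eqP => _; last by rewrite sub0r normrN ger0_norm ?div1r// invr_ge0.
by rewrite mulrBl divff// div1r ger0_norm// subr_ge0 invf_le1 ?(lt_le_trans ltr01).
Qed.

(** Only two moduli occur, one at the identity and one at the other points. A general [f] lets the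
    same count serve the l^1 norm and the l^p norm. *)
Lemma sum_one0 (f : R -> R) :
  \sum_(g : gT) f (rnorm (one0 R gT g : R[i])) =
  f ((n%:R - 1) / n%:R) + (n%:R - 1) * f (1 / n%:R).
Proof.
rewrite (bigD1 1%g)//= rnorm_one0 eqxx; congr (_ + _).
under eq_bigr => g /negbTE g1 do rewrite rnorm_one0 g1.
rewrite sumr_const cardC1 -[LHS]mulr_natl; congr (_ * _).
have : (0 < n)%N by apply/card_gt0P; exists 1%g.
by case: n => // k _; rewrite -natr1 addrK.
Qed.

Lemma ell1_norm_one0 : ell1_norm (one0 R gT) = 2 - 2 / n%:R.
Proof.
have n0 : n%:R != 0 :> R.
  by rewrite pnatr_eq0 -lt0n; apply/card_gt0P; exists 1%g.
by rewrite /ell1_norm (sum_one0 id); field.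
Qed.

Lemma lp_norm_one0 (p : R) : 1 <= p ->
  lp_norm p (one0 R gT) = ((n%:R - 1) `^ p + n%:R - 1) `^ p^-1 / n%:R.
Proof.
move=> p1; have p0 : p != 0 by rewrite gt_eqF// (lt_le_trans ltr01).
have n1 : 1 <= n%:R :> R by rewrite ler1n; apply/card_gt0P; exists 1%g.
have n1' : 0 <= n%:R - 1 :> R by rewrite subr_ge0.
have s0 : 0 <= (n%:R - 1) `^ p + n%:R - 1 :> R by rewrite -addrA addr_ge0 ?powR_ge0.
rewrite /lp_norm (sum_one0 (fun t => t `^ p)) !powRM ?invr_ge0//.
rewrite powR1 mul1r -mulrDl addrA powRM ?powR_ge0//.
by rewrite -powRrM mulfV// powRr1 ?invr_ge0.
Qed.

End AugmentationIdeal.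

(** * Completions of the augmentation ideal *)

Section Completion.
Variables (R : realType) (gT : finGroupType) (p : R) (p1 : 1 <= p).
Local Notation W := (subvs_of (ell10 R gT)).
Implicit Types a b c : W.

Let normF0p a : R := normFp p (vsval a).

Let normF0pD a b : normF0p (a + b) <= normF0p a + normF0p b.
Proof. exact: normFpD. Qed.

Let normF0pZ (k : R[i]) a : normF0p (k *: a) = rnorm k * normF0p a.
Proof. exact: normFpZ. Qed.

Let coordB (g : gT) a b :
  (vsval (a - b) g : R[i]) = vsval a g - vsval b g.
Proof. by rewrite !ffunE. Qed.

Let expand a : a = \sum_(g : gT) (vsval a g : R[i]) *: vsproj (ell10 R gT) (Delta R g).
Proof.
apply: subvs_inj; rewrite [LHS](ell10_expand (subvsP a)) linear_sum.
by apply: eq_bigr => g _; rewrite linearZ/= vsprojK ?Delta_ell10.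
Qed.

Let coord_bound (g : gT) a : rnorm (vsval a g : R[i]) <= normF0p a.
Proof. exact: le_trans (rnorm_le_lp_norm p1 _ _) (lp_norm_le_normFp p1 _). Qed.

(** The spanning family consists of the [Delta R g] for all [g], including the zero vector at
    [g = 1], with the values of [a] as coordinates. The l^p norm, which lies below the full norm,
    controls these values. *)
Definition F0p_coordNorm : coordNorm W gT :=
  CoordNorm normF0pD normF0pZ coordB expand coord_bound.

Definition F0p_space : completeNormedModType R[i] := cnormed F0p_coordNorm.

Lemma vsval_convol0 a b : vsval (convol0 a b) = convol (vsval a) (vsval b).
Proof. by rewrite vsprojK// convol_ell10// subvsP. Qed.

Let mulA : associative (@convol0 R gT).
Proof. by move=> a b c; apply: subvs_inj; rewrite !vsval_convol0 convolA. Qed.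

Let mulDl : left_distributive (@convol0 R gT) +%R.
Proof. by move=> a b c; apply: subvs_inj; rewrite linearD/= !vsval_convol0 convolDl. Qed.

Let mulDr : right_distributive (@convol0 R gT) +%R.
Proof. by move=> a b c; apply: subvs_inj; rewrite linearD/= !vsval_convol0 convolDr. Qed.

Let scaleAl (k : R[i]) a b : convol0 (k *: a) b = k *: convol0 a b.
Proof. by apply: subvs_inj; rewrite linearZ/= !vsval_convol0 convolZl. Qed.

Let scaleAr (k : R[i]) a b : convol0 a (k *: b) = k *: convol0 a b.
Proof. by apply: subvs_inj; rewrite linearZ/= !vsval_convol0 convolZr. Qed.

Let normM (a b : F0p_space) : `|convol0 a b : F0p_space| <= `|a| * `|b|.
Proof.
rewrite !rnormE -rmorphM lecR !rnorm_cnormed /= /normF0p vsval_convol0.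
exact: normFpM.
Qed.

Definition F0p_algebra : banachAlgebra R :=
  @BanachAlgebra R F0p_space (@convol0 R gT) mulA mulDl mulDr scaleAl scaleAr normM.

(** The ideal is complete for its full norm, so it is its own completion and the identity map is the
    embedding. *)
Definition F0p_embedding : {linear W -> F0p_algebra} := (idfun : {linear W -> W}).

Lemma is_F0p_embedding : is_F0p p F0p_embedding.
Proof. by split=> // O [x Ox] _; exists x; split=> //; exists x. Qed.

Variables (A : banachAlgebra R) (j : {linear W -> A}).
Hypothesis F0pj : is_F0p p j.

Lemma completion_norm (a : F0p_space) : rnorm (j a) = rnorm a.
Proof. by case: F0pj => _ -> _. Qed.

Lemma completion_inj : injective j.
Proof.
move=> a b jab; apply/subr0_eq/(@rnorm_eq0 _ F0p_space).
by rewrite -completion_norm linearB/= jab subrr rnorm0.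
Qed.

Let density (x : A) (e : R) : 0 < e -> exists a : F0p_space, rnorm (x - j a) < e.
Proof.
move=> e0; have [_ _ dj] := F0pj.
have [] := dj (ball x e%:C%C).
- by exists x; apply: ballxx; rewrite ltcR.
- by apply: ball_open; rewrite ltcR.
move=> y [xa [a _ ja]]; move: xa.
rewrite -ja -ball_normE /ball_/= (rnormE (x - j a)) ltcR => xa.
by exists a.
Qed.

(* The filter of approximations of [x] is Cauchy for the complete norm of the
   finite-dimensional space, so its limit is a preimage of [x]. *)
Lemma completion_surj (x : A) : exists a, j a = x.
Proof.
pose S (e : R) : set F0p_space := [set a | rnorm (x - j a) < e].
pose F : set_system F0p_space := filter_from [set e : R | 0 < e] S.
have FF : ProperFilter F.
  apply: filter_from_proper; last by move=> e /= /(density x)[a xa]; exists a.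
  apply: filter_from_filter; first by exists 1; exact: ltr01.
  move=> d e /= d0 e0; exists (Num.min d e); first by rewrite /= lt_min d0.
  by move=> a; rewrite /S/= lt_min => /andP[].
(* Since [j] is isometric, two good approximations of [x] are close to each other; this makes [F]
   Cauchy. *)
have dist a b : rnorm (a - b : F0p_space) <= rnorm (x - j a) + rnorm (x - j b).
  rewrite -completion_norm linearB/= -(rnormN (x - j a)) opprB.
  by rewrite (le_trans _ (ler_rnormD _ _))// addrA subrK.
have /cauchy_cvg/cvg_ex[/= l Fl] : cauchy F.
  apply/cauchyP => e e0.
  have eE : (complex.Re e)%:C%C = e by rewrite RRe_real ?gtr0_real.
  have d0 : 0 < complex.Re e / 2 by rewrite divr_gt0// -ltcR eE.
  have [a xa] := density x d0; exists a; exists (complex.Re e / 2) => // b xb.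
  rewrite -ball_normE /ball_/= (rnormE (a - b : F0p_space)) -eE ltcR.
  by rewrite (le_lt_trans (dist a b))// [ltRHS]splitr ltrD.
exists l; apply/esym/subr0_eq/rnorm_eq0/eqP; rewrite eq_le rnorm_ge0 andbT.
apply/ler_addgt0Pr => e e0; rewrite add0r.
have e20 : 0 < e / 2 by rewrite divr_gt0.
have Fe : F (S (e / 2)) by exists (e / 2).
have Fle : F (ball (l : F0p_space) (e / 2)%:C%C).
  by apply: Fl; apply: (@nbhsx_ballx R[i] F0p_space); rewrite ltcR.
have [a [xa]] := filter_ex (filterI Fe Fle).
rewrite -ball_normE /ball_/= (rnormE (l - a : F0p_space)) ltcR => la.
rewrite -[x](subrK (j a)) -addrA -linearB (le_trans (ler_rnormD _ _))//.
by rewrite [leRHS]splitr lerD ?ltW// -opprB linearN rnormN completion_norm.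
Qed.

Lemma completion_bij : bijective j.
Proof.
have [h jh] := choice completion_surj.
by exists h => // a; apply: completion_inj; rewrite jh.
Qed.

(** The inverse of [j], linear because [j] is linear and injective, is followed by coordinates in a
    basis of the ideal. *)
Lemma completion_coordinates :
  exists f : {linear A -> 'rV[R[i]]_(#|gT|.-1)}, bijective f.
Proof.
have [h hj jh] := completion_bij.
have h_lin : linear h.
  by move=> k x y; apply: completion_inj; rewrite linearP !jh.
rewrite -(dim_ell10 R gT).
set U := ell10 R gT; pose e := vbasis U.
pose f (x : A) : 'rV[R[i]]_(\dim U) := \row_i coord e i (vsval (h x)).
have f_lin : linear f.
  by move=> k x y; apply/rowP => i; rewrite !mxE h_lin (linearP vsval) (linearP (coord e i)).
pose fL : {linear A -> 'rV[R[i]]_(\dim U)} := HB.pack f (GRing.isLinear.Build _ _ _ _ f f_lin).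
have sumU (r : 'rV[R[i]]_(\dim U)) : \sum_i r 0 i *: e`_i \in U.
  apply: memv_suml => i _; apply/memvZ/vbasis_mem/mem_nth.
  by rewrite size_tuple.
exists fL; exists (fun r : 'rV[R[i]]_(\dim U) => j (vsproj U (\sum_i r 0 i *: e`_i))) => [x|r].
  rewrite -[RHS]jh -(vsvalK (h x)); congr (j (vsproj U _)).
  rewrite [RHS](coord_vbasis (subvsP (h x))).
  by apply: eq_bigr => i _; rewrite mxE.
apply/rowP => i; rewrite mxE hj vsprojK//.
by rewrite coord_sum_free// (basis_free (vbasisP U)).
Qed.

(** Surjectivity of [j] reduces the identity laws to those already known on the ideal. *)
Lemma completion_identity : is_identity (j (vsproj (ell10 R gT) (one0 R gT))).
Proof.
move=> x; have [a <-] := completion_surj x; have [jM _ _] := F0pj.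
rewrite -!jM; split; congr (j _); apply: subvs_inj;
  rewrite vsval_convol0 vsprojK ?one0_ell10//.
- by rewrite one0_convol ?subvsP.
- by rewrite convol_one0 ?subvsP.
Qed.

Lemma rnorm_completion_one0 :
  rnorm (j (vsproj (ell10 R gT) (one0 R gT))) = normFp p (one0 R gT).
Proof. by case: F0pj => _ -> _; rewrite vsprojK ?one0_ell10. Qed.

End Completion.

(** * Obstructions caused by an identity of norm greater than 1 *)

Section LargeIdentity.
Variables (R : realType) (A : banachAlgebra R) (e : A).
Hypotheses (e_id : is_identity e) (e_gt1 : 1 < rnorm e).

Lemma no_contractive_approx_identity : ~ has_contractive_approx_identity A.
Proof.
move=> [I [le [u [[[i0] refl trans dir] u1 cvu]]]].
have FF : ProperFilter (tails le).
  apply: filter_from_proper; last by move=> i _; exists i => /=; exact: refl.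
  apply: filter_from_filter; first by exists i0.
  move=> i k _ _; have [l [il kl]] := dir i k; exists l => // m /= lm.
  by split; apply: trans lm.
(* Tested on [a = e], the products [u i * e] are [u i] itself, so the net converges to [e]. *)
have [_] := cvu e; under eq_fun do rewrite (e_id _).2.
(* No element of norm at most 1 is within [rnorm e - 1] of [e]. *)
have e1 : 0 < (rnorm e - 1)%:C%C :> R[i] by rewrite ltcR subr_gt0.
move=> /cvgrPdist_lt/(_ _ e1) near_e; have [k] := filter_ex near_e.
rewrite rnormE ltcR ltNge => /negP; apply.
rewrite lerBlDr -[e in leLHS](subrK (u k)).
by rewrite (le_trans (ler_rnormD _ _))// lerD2l.
Qed.

(** [pi e] fixes the span of the ranges, hence every vector by density and continuity. Its operator
    norm is then at most 1, while isometry makes it [rnorm e]. *)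
Lemma not_nondegenerately_representable (E : completeNormedModType R[i]) :
  ~ nondegenerately_representable A E.
Proof.
move=> [pi [[cpi lpi mpi] isopi ndpi]].
have pie_fix x : linear_span [set y | exists a x, y = pi a x] x -> pi e x = x.
  move=> [m [c [s [sP ->]]]]; rewrite linear_sum; apply: eq_bigr => i _.
  by have [a [y ->]] := sP i; rewrite linearZ/= -mpi (e_id a).1.
have pie x : pi e x = x.
  apply/subr0_eq/rnorm_eq0/eqP; rewrite eq_le rnorm_ge0 andbT.
  apply/ler_addgt0Pr => d d0; rewrite add0r.
  (* For [y] in the span, [pi e x - x] is [pi e (x - y) + (y - x)], of norm at most
     [opnorm (pi e) + 1] times that of [x - y]; this fixes the radius below. *)
  have c0 : 0 < opnorm (pi e) + 1 by rewrite ltr_wpDl ?opnorm_ge0.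
  have r0 : 0 < d / (opnorm (pi e) + 1) by rewrite divr_gt0.
  have [] := ndpi (ball x (d / (opnorm (pi e) + 1))%:C%C).
  - by exists x; apply: ballxx; rewrite ltcR.
  - by apply: ball_open; rewrite ltcR.
  move=> y [+ /pie_fix ey]; rewrite -ball_normE /ball_/= (rnormE (x - y)) ltcR => xy.
  have -> : pi e x - x = pi e (x - y) + (y - x).
    by rewrite linearB/= ey addrA subrK.
  rewrite (le_trans (ler_rnormD _ _))//.
  rewrite (le_trans (lerD (le_opnorm _ (cpi e)) (lexx _)))//.
  rewrite -[y - x]opprB rnormN -[X in _ + X]mul1r -mulrDl.
  by rewrite mulrC -ler_pdivlMr// ltW.
have : opnorm (pi e) <= 1.
  by apply: opnorm_le => // x; rewrite pie mul1r.
by rewrite isopi leNgt e_gt1.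
Qed.

End LargeIdentity.

Theorem proposition4p13 (R : realType) (gT : finGroupType) (n : nat) (p : R)
    (cardG : #|gT| = n) (n_ge2 : (2 <= n)%N) (p_ge1 : 1 <= p) :
  (* (1) *)
  ([/\ exists (A : banachAlgebra R) (j : {linear subvs_of (ell10 R gT) -> A}),
         is_F0p p j,
       forall (A : banachAlgebra R) (j : {linear subvs_of (ell10 R gT) -> A}),
         is_F0p p j ->
         bijective j /\
         exists f : {linear A -> 'rV[R[i]]_n.-1}, bijective f,
       ell10 R gT = <<[seq Delta R g | g : gT]>>%VS
     & [set` ell10 R gT] = @Cfin0 R gT]) /\
  (* (2) *)
  (forall a : ell1 R gT, a \in ell10 R gT ->
     convol a (\sum_(g : gT) delta R g) = 0 /\
     convol (\sum_(g : gT) delta R g) a = 0) /\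
  (* (3) *)
  (one0 R gT \in ell10 R gT /\
   forall (A : banachAlgebra R) (j : {linear subvs_of (ell10 R gT) -> A}),
     is_F0p p j -> is_identity (j (vsproj (ell10 R gT) (one0 R gT)))) /\
  (* (4) *)
  (((n%:R - 1) `^ p + n%:R - 1) `^ p^-1 / n%:R <= normFp p (one0 R gT) /\
   normFp p (one0 R gT) <= 2 - 2 / n%:R) /\
  (* (5) *)
  ell1_norm (one0 R gT) = 2 - 2 / n%:R /\
  (* (6) *)
  ((2 < n)%N ->
   forall (A : banachAlgebra R) (j : {linear subvs_of (ell10 R gT) -> A}),
     is_F0p 1 j -> ~ is_unit (j (vsproj (ell10 R gT) (one0 R gT)))) /\
  (* (7) *)
  ((2 < n)%N ->
   forall (A : banachAlgebra R) (j : {linear subvs_of (ell10 R gT) -> A}),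
     is_F0p 1 j ->
     ~ has_contractive_approx_identity A /\
     forall E : completeNormedModType R[i],
       ~ nondegenerately_representable A E).
Proof.
subst n; have n_gt0 : (0 < #|gT|)%N by exact: ltnW.
have one0_gt1 (A : banachAlgebra R) (j : {linear subvs_of (ell10 R gT) -> A}) :
    (2 < #|gT|)%N -> is_F0p 1 j ->
    1 < rnorm (j (vsproj (ell10 R gT) (one0 R gT))).
  move=> n3 F0pj; rewrite (rnorm_completion_one0 F0pj).
  apply: lt_le_trans (lp_norm_le_normFp (lexx 1) _).
  have m0 : 0 <= #|gT|%:R - 1 :> R by rewrite subr_ge0 ler1n.
  have m1 : 0 <= #|gT|%:R - 1 + #|gT|%:R - 1 :> R by rewrite -addrA addr_ge0.
  rewrite lp_norm_one0// invr1 (powRr1 m0) (powRr1 m1).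
  rewrite ltr_pdivlMr ?ltr0n// mul1r addrAC ltrDr.
  by rewrite -addrA -opprD subr_gt0 -(natrD _ 1 1) ltr_nat.
split; first split.
- by exists (F0p_algebra gT p_ge1), (F0p_embedding gT p_ge1); exact: is_F0p_embedding.
- move=> A j F0pj; split; first exact: completion_bij F0pj.
  exact: completion_coordinates F0pj.
- exact: ell10_span.
- exact: ell10_Cfin0.
split.
  move=> a; rewrite mem_ell10 => /eqP a0.
  by rewrite convol_all_one all_one_convol a0 scale0r.
split.
  split; first exact: one0_ell10.
  by move=> A j F0pj; exact: completion_identity F0pj.
split.
  split; first by rewrite -lp_norm_one0// lp_norm_le_normFp.
  by rewrite -ell1_norm_one0 normFp_le_ell1.
split; first exact: ell1_norm_one0.
split.
  move=> n3 A j F0pj [_ j1].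
  by have := one0_gt1 A j n3 F0pj; rewrite j1 ltxx.
move=> n3 A j F0pj; have e_gt1 := one0_gt1 A j n3 F0pj.
have e_id := completion_identity (lexx 1) F0pj.
split; first exact: no_contractive_approx_identity e_id e_gt1.
move=> E; exact: (not_nondegenerately_representable e_id e_gt1 (E := E)).
Qed.
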